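(* Let $n\ge2$ and consider the interconnection $$\dot x_j\in F_j(x,u),\ j=1,\dots,n,\quad (x,u)\in\mathcal C;\qquad x_j^+\in G_j(x,u),\ j=1,\dots,n,\quad (x,u)\in\mathcal D,$$ of hybrid subsystems $\Sigma_1,\dots,\Sigma_n$, where each $\Sigma_j$ admits a candidate exponential ISS Lyapunov function $V_j:\mathcal X_j\to\mathbb R_+$ w.r.t. a nonempty compact set $\mathcal A_j\subset\mathcal X_j$ with rate coefficients $c_j,d_j\in\mathbb R$, internal gains $\chi_{jk}$ and external gain $\chi_j$. Let $I_c:=\{j:c_j<0\}$, and consider the augmented interconnection $\tilde\Sigma$ (defined in the context) in which each subsystem with index $j\in I_c$ is augmented with a reverse average dwell-time clock $\tau_j\in[0,N_{0j}^*\delta_j^*]$ with integer $N_{0j}^*\ge1$ and $\delta_j^*>0$. For scalars $L_j\ge0$, define $W_j:\mathcal Z_j\to\mathbb R_+$, $j=1,\dots,n$, by $$W_j(z_j):=\begin{cases}V_j(x_j)&\text{if }j\notin I_c;\\ e^{-L_j\tau_j}V_j(x_j)&\text{if }j\in I_c.\end{cases}$$ Then for each $i\in\{1,\dots,n\}$, $W_i$ is a candidate exponential ISS Lyapunov function w.r.t. $$\tilde{\mathcal A}_i:=\begin{cases}\mathcal A_i&\text{if }i\notin I_c;\\ \mathcal A_i\times[0,N_{0i}^*\delta_i^*]&\text{if }i\in I_c\end{cases}$$ for the augmented subsystem $\tilde\Sigma_i$ with rate coefficients $$\begin{cases}\tilde c_i:=c_i,\ \tilde d_i:=d_i&\text{if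 }i\notin I_c;\\ \tilde c_i:=c_i+L_i,\ \tilde d_i:=d_i-L_i\delta_i^*&\text{if }i\in I_c.\end{cases}$$ More specifically, $W_i$ is locally Lipschitz outside $\tilde{\mathcal A}_i$ and: 1. there exist $\tilde\psi_{i1},\tilde\psi_{i2}\in\mathcal K_\infty$ such that $\tilde\psi_{i1}(|z_i|_{\tilde{\mathcal A}_i})\le W_i(z_i)\le\tilde\psi_{i2}(|z_i|_{\tilde{\mathcal A}_i})$ for all $z_i\in\mathcal Z_i$; 2. with internal gains $\tilde\chi_{ij}\in\mathcal K$, $j\ne i$, defined by $$\tilde\chi_{ij}(r):=\begin{cases}\chi_{ij}(r)&\text{for }j\notin I_c;\\ \chi_{ij}(e^{L_jN_{0j}^*\delta_j^*}r)&\text{for }j\in I_c\end{cases}$$ and $\tilde\chi_{ii}\equiv0$, there exists an external gain $\tilde\chi_i\in\mathcal K$ such that for all $(z,u)\in\tilde{\mathcal C}$ with $z_i\notin\tilde{\mathcal A}_i$, $$W_i(z_i)\ge\max\Big\{\max_{j=1}^n\tilde\chi_{ij}(W_j(z_j)),\,\tilde\chi_i(|u|)\Big\}$$ implies $$\dot W_i(z_i;y_i)\le-\tilde c_iW_i(z_i)\qquad\forall y_i\in\tilde F_i(z,u);$$ 3. for all $(z,u)\in\tilde{\mathcal D}$ (with the same $\tilde\chi_{ij},\tilde\chi_i$), $$W_i(y_i)\le\max\Big\{e^{-\tilde d_i}W_i(z_i),\,\max_{j=1}^n\tilde\chi_{ij}(W_j(z_j)),\,\tilde\chi_i(|u|)\Big\}\qquad\forall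 y_i\in\tilde G_i(z,u).$$
   Context: Notation. $\mathbb R_+=[0,\infty)$; $|\cdot|$ is the Euclidean norm and $|x|_{\mathcal A}=\inf_{y\in\mathcal A}|x-y|$. $\alpha:\mathbb R_+\to\mathbb R_+$ is of class $\mathcal K$ if continuous, strictly increasing and $\alpha(0)=0$; of class $\mathcal K_\infty$ if in addition unbounded. The Dini derivative of a locally Lipschitz $V$ at $x$ in direction $y$ is $\dot V(x;y):=\limsup_{h\searrow0}\frac{V(x+hy)-V(x)}{h}$ (over $h>0$ for which $V(x+hy)$ is defined). Interconnection. $x=(x_1,\dots,x_n)\in\mathcal X=\mathcal X_1\times\cdots\times\mathcal X_n$ with $x_j\in\mathcal X_j\subset\mathbb R^{N_j}$ is the state; $u\in\mathcal U\subset\mathbb R^M$ is the common external input; $\mathcal C=\mathcal C_1\times\cdots\times\mathcal C_n\times\mathcal C_u$ with $\mathcal C_j\subset\mathcal X_j$, $\mathcal C_u\subset\mathcal U$ is the flow set; $\mathcal D=\mathcal D_1\times\cdots\times\mathcal D_n\times\mathcal D_u$ with $\mathcal D_j\subset\mathcal X_j$, $\mathcal D_u\subset\mathcal U$ is the jump set; $F_j:\mathcal C\rightrightarrows\mathbb R^{N_j}$ and $G_j:\mathcal D\rightrightarrows\mathcal X_j$ are set-valued maps. The dynamics of $x_j$ is the subsystem $\Sigma_j$. Candidate exponential ISS Lyapunov function for a subsystem. $V_i:\mathcal X_i\to\mathbb R_+$ is a candidate exponential ISS Lyapunov function w.r.t. $\mathcal A_i$ for $\Sigma_i$ with rate coefficients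 $c_i,d_i\in\mathbb R$ if it is locally Lipschitz outside $\mathcal A_i$ and: (1) there are $\psi_{i1},\psi_{i2}\in\mathcal K_\infty$ with $\psi_{i1}(|x_i|_{\mathcal A_i})\le V_i(x_i)\le\psi_{i2}(|x_i|_{\mathcal A_i})$ for all $x_i\in\mathcal X_i$; (2) there are internal gains $\chi_{ij}\in\mathcal K$ for $j\ne i$, $\chi_{ii}\equiv0$, and an external gain $\chi_i\in\mathcal K$ such that for all $(x,u)\in\mathcal C$ with $x_i\notin\mathcal A_i$, $V_i(x_i)\ge\max\{\max_{j=1}^n\chi_{ij}(V_j(x_j)),\chi_i(|u|)\}$ implies $\dot V_i(x_i;y_i)\le-c_iV_i(x_i)$ for all $y_i\in F_i(x,u)$; (3) for all $(x,u)\in\mathcal D$ and all $y_i\in G_i(x,u)$, $V_i(y_i)\le\max\{e^{-d_i}V_i(x_i),\max_{j=1}^n\chi_{ij}(V_j(x_j)),\chi_i(|u|)\}$. Augmented interconnection. For $j\notin I_c$: $z_j:=x_j\in\mathcal Z_j:=\mathcal X_j$, $\tilde{\mathcal C}_j:=\mathcal C_j$, $\tilde{\mathcal D}_j:=\mathcal D_j$, $\tilde F_j(z,u):=F_j(x,u)$, $\tilde G_j(z,u):=G_j(x,u)$. For $j\in I_c$: $z_j:=(x_j,\tau_j)\in\mathcal Z_j:=\mathcal X_j\times[0,N_{0j}^*\delta_j^*]$, $\tilde{\mathcal C}_j:=\mathcal C_j\times[0,N_{0j}^*\delta_j^*]$, $\tilde{\mathcal D}_j:=\mathcal D_j\times[0,N_{0j}^*\delta_j^*]$,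 $\tilde F_j(z,u):=F_j(x,u)\times\{1\}$, $\tilde G_j(z,u):=G_j(x,u)\times\{\max\{0,\tau_j-\delta_j^*\}\}$. The augmented interconnection $\tilde\Sigma$ has state $z=(z_1,\dots,z_n)\in\mathcal Z_1\times\cdots\times\mathcal Z_n$, input $u\in\mathcal U$, flow set $\tilde{\mathcal C}:=\tilde{\mathcal C}_1\times\cdots\times\tilde{\mathcal C}_n\times\mathcal C_u$, jump set $\tilde{\mathcal D}:=\tilde{\mathcal D}_1\times\cdots\times\tilde{\mathcal D}_n\times\mathcal D_u$, and dynamics $\dot z_j\in\tilde F_j(z,u)$ for $(z,u)\in\tilde{\mathcal C}$, $z_j^+\in\tilde G_j(z,u)$ for $(z,u)\in\tilde{\mathcal D}$, $j=1,\dots,n$; $x$ denotes the vector of $x$-components of $z$. The dynamics of $z_j$ is the augmented subsystem $\tilde\Sigma_j$. *)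

(* Defs.v *)
(* MathComp-Analysis, over an arbitrary realType. *)
From HB Require Import structures.
From mathcomp Require Export all_boot all_order all_algebra.
From mathcomp Require Export all_classical all_reals all_analysis.

Export Order.TTheory GRing.Theory Num.Theory numFieldNormedType.Exports.

Set Implicit Arguments.
Unset Strict Implicit.
Unset Printing Implicit Defensive.

Local Open Scope classical_set_scope.
Local Open Scope ring_scope.

Section Basics.
Context {R : realType}.

(* The library norm on row vectors is the sup norm, hence this one. *)
Definition enorm p (x : 'rV[R]_p) : R := Num.sqrt (\sum_k x 0 k ^+ 2).

Definition dist_to p (A : set 'rV[R]_p) (x : 'rV[R]_p) : R :=
  inf [set enorm (x - y) | y in A].

(* Functions on [0, oo) are total functions on R constrained on [0, oo) only. *)
Definition classK (alpha : R -> R) : Prop :=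
  [/\ {within `[0, +oo[, continuous alpha},
      {in `[0, +oo[ &, {homo alpha : r s / r < s}}
    & alpha 0 = 0].

Definition classKinf (alpha : R -> R) : Prop :=
  classK alpha /\ (forall m : R, exists2 r, 0 <= r & m < alpha r).

(* A function V : X -> R with X a subset of R^p is a total function on R^p
   whose values outside X are never used. *)
Definition locally_lipschitz_on p (V : 'rV[R]_p -> R) (D : set 'rV[R]_p) : Prop :=
  forall x, D x -> exists r k : R, 0 < r /\
    forall y z, D y -> D z -> enorm (y - x) < r -> enorm (z - x) < r ->
      `|V y - V z| <= k * enorm (y - z).

(* Only those h > 0 with x + h y in the domain X of V count.  The limsup is
   extended-real valued; it is -oo when no small h qualifies. *)
Definition dini p (X : set 'rV[R]_p) (V : 'rV[R]_p -> R) (x y : 'rV[R]_p) : \bar R :=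
  limf_esup (fun h : R => ((V (x + h *: y) - V x) / h)%:E)
            (within [set h | X (x + h *: y)] 0^'+).

End Basics.

Section Interconnection.
Context {R : realType} {n : nat}.

Definition state (N : 'I_n -> nat) : Type := forall j : 'I_n, 'rV[R]_(N j).

(* The maps sys_F j and sys_G j are only meaningful on flow_set and jump_set. *)
Record interconnection (N : 'I_n -> nat) (M : nat) := Interconnection {
  sys_X  : forall j, set 'rV[R]_(N j);
  sys_U  : set 'rV[R]_M;
  sys_C  : forall j, set 'rV[R]_(N j);
  sys_Cu : set 'rV[R]_M;
  sys_D  : forall j, set 'rV[R]_(N j);
  sys_Du : set 'rV[R]_M;
  sys_F  : forall j, state N -> 'rV[R]_M -> set 'rV[R]_(N j);
  sys_G  : forall j, state N -> 'rV[R]_M -> set 'rV[R]_(N j) }.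

End Interconnection.

Arguments sys_X {R n N M} _ _ _.
Arguments sys_C {R n N M} _ _ _.
Arguments sys_D {R n N M} _ _ _.
Arguments sys_F {R n N M} _ _ _ _ _.
Arguments sys_G {R n N M} _ _ _ _ _.

Section Candidate.
Context {R : realType} {n : nat} {N : 'I_n -> nat} {M : nat}
        (S : @interconnection R n N M).

Definition flow_set (x : state N) (u : 'rV[R]_M) : Prop :=
  (forall j, sys_C S j (x j)) /\ sys_Cu S u.

Definition jump_set (x : state N) (u : 'rV[R]_M) : Prop :=
  (forall j, sys_D S j (x j)) /\ sys_Du S u.

Definition well_formed : Prop :=
  [/\ forall j, sys_C S j `<=` sys_X S j, forall j, sys_D S j `<=` sys_X S j,
      sys_Cu S `<=` sys_U S, sys_Du S `<=` sys_U S
    & forall x u, jump_set x u -> forall j, sys_G S j x u `<=` sys_X S j].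

(* V i is a candidate exponential ISS Lyapunov function with respect to A for
   the i-th subsystem, with rate coefficients c, d, internal gains chi j and
   external gain chiu.  The base value 0 of the maxima is harmless: all the
   quantities compared are nonnegative. *)
Definition candidate_exp_ISS_Lyapunov (V : forall j, 'rV[R]_(N j) -> R)
    (i : 'I_n) (A : set 'rV[R]_(N i)) (c d : R)
    (chi : 'I_n -> R -> R) (chiu : R -> R) : Prop :=
  (forall x, sys_X S i x -> 0 <= V i x) /\
  locally_lipschitz_on (V i) (sys_X S i `\` A) /\
  (exists psi1 psi2 : R -> R, [/\ classKinf psi1, classKinf psi2 &
     forall x, sys_X S i x ->
       psi1 (dist_to A x) <= V i x <= psi2 (dist_to A x)]) /\
  (forall j, j != i -> classK (chi j)) /\
  (forall r, 0 <= r -> chi i r = 0) /\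
  classK chiu /\
  (forall x u, flow_set x u -> ~ A (x i) ->
     V i (x i) >= Num.max (\big[Num.max/0]_(j < n) chi j (V j (x j)))
                          (chiu (enorm u)) ->
     forall y, sys_F S i x u y ->
       (dini (sys_X S i) (V i) (x i) y <= (- c * V i (x i))%:E)%E) /\
  (forall x u, jump_set x u -> forall y, sys_G S i x u y ->
     V i y <= Num.max (expR (- d) * V i (x i))
                (Num.max (\big[Num.max/0]_(j < n) chi j (V j (x j)))
                         (chiu (enorm u)))).

End Candidate.

Section AugmentedStates.
Context {R : realType}.

(* A flag b : bool says whether a state in R^p is augmented with a clock,
   stored as the last coordinate, or left unchanged. *)
Definition aug_dim (b : bool) (p : nat) : nat := if b then (p + 1)%N else p.

Definition plant (b : bool) p : 'rV[R]_(aug_dim b p) -> 'rV[R]_p :=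
  if b as b0 return 'rV[R]_(aug_dim b0 p) -> 'rV[R]_p
  then fun z => lsubmx z else fun z => z.

(* The value 0 for b = false is a placeholder. *)
Definition clock (b : bool) p : 'rV[R]_(aug_dim b p) -> R :=
  if b as b0 return 'rV[R]_(aug_dim b0 p) -> R
  then fun z => rsubmx (z : 'rV_(p + 1)) 0 0 else fun=> 0.

(* A x T if b, and A otherwise. *)
Definition aug_set (b : bool) p (A : set 'rV[R]_p) (T : set R) :
    set 'rV[R]_(aug_dim b p) :=
  if b as b0 return set 'rV[R]_(aug_dim b0 p)
  then [set z : 'rV[R]_(p + 1) | A (lsubmx z) /\ T (rsubmx z 0 0)] else A.

Definition aug_fun (b : bool) p (l : R) (V : 'rV[R]_p -> R)
    (z : 'rV[R]_(aug_dim b p)) : R :=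
  if b then expR (- (l * clock z)) * V (plant z) else V (plant z).

End AugmentedStates.

Arguments plant {R} {b p} _.
Arguments clock {R} {b p} _.
Arguments aug_set {R} b {p} _ _ _.
Arguments aug_fun {R} b {p} _ _ _.

Section Augmentation.
Context {R : realType}.

Definition clock_range (N0 : nat) (delta : R) : set R :=
  `[0, N0%:R * delta]%classic.

Definition augment n (N : 'I_n -> nat) M (S : @interconnection R n N M)
    (I : pred 'I_n) (N0 : 'I_n -> nat) (delta : 'I_n -> R) :
    @interconnection R n (fun j => aug_dim (I j) (N j)) M :=
  let T j := clock_range (N0 j) (delta j) in
  let x (z : state (fun j => aug_dim (I j) (N j))) : @state R n N :=
    fun j => plant (z j) in
  @Interconnection R n (fun j => aug_dim (I j) (N j)) M
    (fun j => aug_set (I j) (sys_X S j) (T j))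
    (sys_U S)
    (fun j => aug_set (I j) (sys_C S j) (T j))
    (sys_Cu S)
    (fun j => aug_set (I j) (sys_D S j) (T j))
    (sys_Du S)
    (fun j z u => aug_set (I j) (sys_F S j (x z) u) [set 1])
    (fun j z u => aug_set (I j) (sys_G S j (x z) u)
                    [set Num.max 0 (clock (z j) - delta j)]).

Definition aug_gain n (I : pred 'I_n) (N0 : 'I_n -> nat) (delta L : 'I_n -> R)
    (chi : 'I_n -> 'I_n -> R -> R) (i j : 'I_n) (r : R) : R :=
  if j == i then 0
  else if I j then chi i j (expR (L j * (N0 j)%:R * delta j) * r)
  else chi i j r.

Definition unstable_flow n (c : 'I_n -> R) : pred 'I_n := fun j => c j < 0.

End Augmentation.

(* Main.v *)
Require Import Defs.
From mathcomp Require Import ring lra.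

(** The clock enters only through the factor [exp (- L tau)], which lies
    between [exp (- L tmax)] and 1 because [tau] ranges from 0 to [tmax], the
    product of [N0] and [delta].  Hence [W] and [V] are within constant
    factors of each other, [W <= V <= exp (L tmax) W], and every requirement on
    [W_i] comes down to the one on [V_i].
    - Sandwich bounds: points are at the same distance from the augmented [A] as
      their plant components from [A] ([dist_to_aug]), so the upper bound is
      kept and the lower one is multiplied by [exp (- L tmax)].
    - Gains: evaluating [chi_ij] at [exp (L_j tmax_j) W_j >= V_j] can only
      enlarge it ([le_aug_gain]).  Hence a state that satisfies the premise of
      the flow condition for [W_i] satisfies it for [V_i], and the bound on
      [V_i] after a jump is also covered by the new gains.  The external gain
      is left as it is.
    - Flow: the clock runs at speed 1, so the factor contributes [- L W] to the
      Dini derivative ([dini_aug]).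
    - Jump: the clock decreases by at most [delta], so the factor grows by at
      most [exp (L delta)] ([aug_fun_jump]).

    States with and without a clock are treated together whenever possible:
    the clock reads 0 when there is none, so the same formula for [W] holds
    ([aug_funE]). *)

Set Implicit Arguments.
Unset Strict Implicit.
Unset Printing Implicit Defensive.

Local Open Scope classical_set_scope.
Local Open Scope ring_scope.

(** * States augmented with a clock *)

Section AugmentedState.
Context {R : realType}.
Implicit Types (b : bool) (p : nat).

Lemma aug_setP b p (A : set 'rV[R]_p) (T : set R) (z : 'rV[R]_(aug_dim b p)) :
  aug_set b A T z <-> A (plant z) /\ (b -> T (clock z)).
Proof.
case: b z => z /=; split=> //; first by case.
- by case=> Az /(_ isT).
- by case.
Qed.

Lemma aug_setD b p (X A : set 'rV[R]_p) (T : set R) :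
  aug_set b X T `\` aug_set b A T = aug_set b (X `\` A) T.
Proof.
apply/seteqP; split=> z.
- by case=> /aug_setP[Xz Tz] nAz; apply/aug_setP; split=> //; split=> // Az;
    apply: nAz; apply/aug_setP.
- by move=> /aug_setP[[Xz nAz] Tz]; split; [apply/aug_setP|case/aug_setP].
Qed.

Lemma aug_funE b p (l : R) (V : 'rV[R]_p -> R) (z : 'rV[R]_(aug_dim b p)) :
  aug_fun b l V z = expR (- (l * clock z)) * V (plant z).
Proof. by case: b z => z //=; rewrite mulr0 oppr0 expR0 mul1r. Qed.

Lemma aug_fun_id b p (l : R) (V : 'rV[R]_p -> R) (z : 'rV[R]_(aug_dim b p)) :
  ~~ b -> aug_fun b l V z = V (plant z).
Proof. by case: b z. Qed.

Lemma aug_fun_ge0 b p (l : R) (V : 'rV[R]_p -> R) (z : 'rV[R]_(aug_dim b p)) :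
  0 <= V (plant z) -> 0 <= aug_fun b l V z.
Proof. by move=> V0; rewrite aug_funE mulr_ge0 ?expR_ge0. Qed.

Lemma aug_fun_le b p (l : R) (V : 'rV[R]_p -> R) (z : 'rV[R]_(aug_dim b p)) :
  0 <= l -> 0 <= V (plant z) -> (b -> 0 <= clock z) ->
  aug_fun b l V z <= V (plant z).
Proof.
case: b z => //= z l0 V0 /(_ isT) t0.
by rewrite ler_piMl // -expR0 ler_expR oppr_le0 mulr_ge0.
Qed.

Lemma aug_fun_ge b p (l tmax : R) (V : 'rV[R]_p -> R)
    (z : 'rV[R]_(aug_dim b p)) :
  0 <= l -> 0 <= V (plant z) -> (b -> clock z <= tmax) ->
  V (plant z) <= (if b then expR (l * tmax) else 1) * aug_fun b l V z.
Proof.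
case: b z => /= z l0 V0; last by rewrite mul1r.
move=> /(_ isT) zt; rewrite mulrA -expRD ler_peMl // -expR0 ler_expR.
by rewrite subr_ge0 ler_wpM2l.
Qed.

(** * Euclidean norm and distance of augmented states *)

Lemma plantB b p (y z : 'rV[R]_(aug_dim b p)) :
  plant (y - z) = plant y - plant z.
Proof. by case: b y z => y z //=; apply/rowP=> k; rewrite !mxE. Qed.

Lemma clockB b p (y z : 'rV[R]_(aug_dim b p)) :
  clock (y - z) = clock y - clock z.
Proof. by case: b y z => y z /=; rewrite ?subr0 // !mxE. Qed.

Lemma enorm_ge0 p (x : 'rV[R]_p) : 0 <= enorm x.
Proof. exact: sqrtr_ge0. Qed.

Lemma sqr_enorm p (x : 'rV[R]_p) : enorm x ^+ 2 = \sum_k x 0 k ^+ 2.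
Proof. by rewrite sqr_sqrtr // sumr_ge0 // => k _; rewrite sqr_ge0. Qed.

Lemma sqr_enorm_aug b p (z : 'rV[R]_(aug_dim b p)) :
  enorm z ^+ 2 = enorm (plant z) ^+ 2 + clock z ^+ 2.
Proof.
case: b z => z /=; last by rewrite expr0n addr0.
rewrite !sqr_enorm big_split_ord big_ord1 /= !mxE.
by congr (_ + _); apply: eq_bigr => k _; rewrite mxE.
Qed.

Lemma enorm_plant_le b p (z : 'rV[R]_(aug_dim b p)) :
  enorm (plant z) <= enorm z.
Proof.
rewrite -(@ler_pXn2r _ 2) ?nnegrE ?enorm_ge0 // sqr_enorm_aug.
by rewrite lerDl sqr_ge0.
Qed.

Lemma normr_clock_le b p (z : 'rV[R]_(aug_dim b p)) : `|clock z| <= enorm z.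
Proof.
rewrite -(@ler_pXn2r _ 2) ?nnegrE ?enorm_ge0 // sqr_enorm_aug real_normK ?num_real //.
by rewrite lerDr sqr_ge0.
Qed.

(** A point [a] of [A] can be paired with the clock value of [z] itself, so the
    clock coordinate never adds to the distance. *)
Lemma dist_to_aug b p (A : set 'rV[R]_p) (T : set R)
    (z : 'rV[R]_(aug_dim b p)) :
  A !=set0 -> (b -> T (clock z)) ->
  dist_to (aug_set b A T) z = dist_to A (plant z).
Proof.
move=> [a0 Aa0] Tz.
have lbE q (B : set 'rV[R]_q) x : has_lbound [set enorm (x - y) | y in B].
  by exists 0 => _ [y _ <-]; exact: enorm_ge0.
have lift a : A a -> exists2 y, aug_set b A T y & enorm (z - y) = enorm (plant z - a).
  move=> Aa; case: b z Tz => z Tz; last by exists a.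
  exists (row_mx a (rsubmx (z : 'rV_(p + 1)))).
    by split; rewrite ?row_mxKl ?row_mxKr //; exact: Tz.
  apply/eqP; rewrite -(@eqrXn2 _ 2) ?enorm_ge0 // (sqr_enorm_aug (b := true)).
  rewrite (plantB (b := true)) (clockB (b := true)) /= row_mxKl row_mxKr.
  by rewrite subrr expr0n addr0.
apply/eqP; rewrite eq_le; apply/andP; split.
- apply: lb_le_inf; first by exists (enorm (plant z - a0)); exists a0.
  move=> _ [a Aa <-]; have [y Ay <-] := lift _ Aa.
  by apply: ge_inf; [exact: lbE|exists y].
- apply: lb_le_inf.
    by have [y Ay _] := lift _ Aa0; exists (enorm (z - y)); exists y.
  move=> _ [y /aug_setP[Ay _] <-]; apply: (@le_trans _ _ (enorm (plant z - plant y))).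
    by apply: ge_inf; [exact: lbE|exists (plant y)].
  by rewrite -plantB enorm_plant_le.
Qed.

(** * Local Lipschitz continuity *)

Lemma expRN_lipschitz (s t : R) : 0 <= s -> 0 <= t ->
  `|expR (- s) - expR (- t)| <= `|s - t|.
Proof.
wlog st : s t / s <= t => [wl s0 t0|s0 t0].
  have [st|/ltW ts] := leP s t; first exact: wl.
  by rewrite distrC (distrC s); exact: wl.
rewrite ger0_norm ?subr_ge0 ?ler_expR ?lerN2 // ler0_norm ?subr_le0 // opprB.
have -> : expR (- t) = expR (- s) * expR (- (t - s)).
  by rewrite -expRD; congr expR; ring.
have es1 : expR (- s) <= 1 by rewrite -expR0 ler_expR oppr_le0.
have es0 := expR_ge0 (- s).
have et1 : expR (- (t - s)) <= 1 by rewrite -expR0 ler_expR oppr_le0 subr_ge0.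
have := expR_ge1Dx (- (t - s)); nra.
Qed.

(** A product of two locally Lipschitz and locally bounded functions; the
    exponential is globally [l]-Lipschitz and at most 1 because clock values are
    nonnegative. *)
Lemma locally_lipschitz_aug b p (D : set 'rV[R]_p) (T : set R) (l : R)
    (V : 'rV[R]_p -> R) :
  0 <= l -> (forall t, T t -> 0 <= t) ->
  locally_lipschitz_on V D -> locally_lipschitz_on (aug_fun b l V) (aug_set b D T).
Proof.
move=> l0 T0 lipV x /aug_setP[Dx _].
have [r [k [r0 Vk]]] := lipV _ Dx.
have clock_ge0 z : aug_set b D T z -> 0 <= clock z.
  move=> /aug_setP[_]; case: b {x Dx Vk} z => z //= /(_ isT); exact: T0.
(* The first summand bounds the variation of V, the second that of the
   exponential times the bound |V x| + |k| r of |V| on the ball; |k| is used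
   since k may be negative. *)
exists r, (`|k| + (`|V (plant x)| + `|k| * r) * l); split=> // y z Dy Dz yx zx.
have [DVy _] := (aug_setP _ _ _).1 Dy; have [DVz _] := (aug_setP _ _ _).1 Dz.
have yx' : enorm (plant y - plant x) < r.
  by rewrite -plantB (le_lt_trans (enorm_plant_le _)).
have zx' : enorm (plant z - plant x) < r.
  by rewrite -plantB (le_lt_trans (enorm_plant_le _)).
have xx' : enorm (plant x - plant x) < r.
  by rewrite subrr /enorm big1 ?sqrtr0 // => j _; rewrite mxE expr0n.
have Vz : `|V (plant z)| <= `|V (plant x)| + `|k| * r.
  have -> : V (plant z) = V (plant x) + (V (plant z) - V (plant x)) by ring.
  rewrite (le_trans (ler_normD _ _)) // lerD2l.
  rewrite (le_trans (Vk _ _ DVz Dx zx' xx')) //.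
  rewrite (le_trans (ler_wpM2r (enorm_ge0 _) (ler_norm k))) //.
  by rewrite ler_wpM2l // ltW.
have Vyz : `|V (plant y) - V (plant z)| <= `|k| * enorm (y - z).
  rewrite (le_trans (Vk _ _ DVy DVz yx' zx')) //.
  rewrite (le_trans (ler_wpM2r (enorm_ge0 _) (ler_norm k))) //.
  by rewrite ler_wpM2l // -plantB enorm_plant_le.
have eyz : `|expR (- (l * clock y)) - expR (- (l * clock z))| <= l * enorm (y - z).
  rewrite (le_trans (expRN_lipschitz _ _)) ?mulr_ge0 ?clock_ge0 //.
  by rewrite -mulrBr normrM ger0_norm // ler_wpM2l // -clockB normr_clock_le.
have ey1 : expR (- (l * clock y)) <= 1.
  by rewrite -expR0 ler_expR oppr_le0 mulr_ge0 // clock_ge0.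
rewrite !aug_funE.
set ey := expR _ in eyz ey1 *; set ez := expR _ in eyz *.
have -> : ey * V (plant y) - ez * V (plant z) =
    ey * (V (plant y) - V (plant z)) + V (plant z) * (ey - ez) by ring.
rewrite (le_trans (ler_normD _ _)) // !normrM mulrDl lerD //.
- by rewrite ger0_norm ?expR_ge0 // -[leRHS]mul1r ler_pM ?expR_ge0.
- by rewrite -mulrA ler_pM.
Qed.

(** * Dini derivative *)

(** The usual epsilon form of an upper bound on a limsup.  When no small
    [h] stays in [X], e.g. when the clock has reached its maximum, both sides
    hold vacuously. *)
Lemma dini_leP p (X : set 'rV[R]_p) (V : 'rV[R]_p -> R) (x y : 'rV[R]_p) (r : R) :
  (dini X V x y <= r%:E)%E <->
  forall e, 0 < e ->
    \forall h \near 0^'+, X (x + h *: y) -> (V (x + h *: y) - V x) / h <= r + e.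
Proof.
split=> [dr e e0|near_le].
- have : (dini X V x y < (r + e)%:E)%E.
    by rewrite (le_lt_trans dr) // lte_fin ltrDl.
  move=> /ereal_inf_lt[_ [B FB <-] supB].
  apply: filterS FB => h Bh; rewrite -lee_fin (le_trans _ (ltW supB)) //.
  by apply: ereal_sup_ubound; exists h.
- apply/lee_addgt0Pr => e e0; rewrite -EFinD.
  apply: le_trans (ereal_inf_lbound _) _.
    by exists [set h | (V (x + h *: y) - V x) / h <= r + e];
      [exact: near_le e0|reflexivity].
  by apply: ge_ereal_sup => _ [h /= hB <-]; rewrite lee_fin.
Qed.

(** Writing [a] and [g] for the values of [exp (- l s)] at [s = tau] and
    [s = h], the increment of [W] is [a (g V (x + h y) - V x)].  As
    [1 - g >= l h g], it is at most [a g h] times the difference quotient of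
    [V] minus [l V x], and [g] tends to 1. *)
Lemma dini_aug b p (X F : set 'rV[R]_p) (T : set R) (V : 'rV[R]_p -> R) (l c : R)
    (z y : 'rV[R]_(aug_dim b p)) :
  0 <= l -> 0 <= V (plant z) -> (b -> 0 <= clock z) ->
  aug_set b F [set 1] y ->
  (dini X V (plant z) (plant y) <= (- c * V (plant z))%:E)%E ->
  (dini (aug_set b X T) (aug_fun b l V) z y <=
     (- (if b then c + l else c) * aug_fun b l V z)%:E)%E.
Proof.
case: b z y => z y l0 V0 // /(_ isT) t0 [_ /= y1] /dini_leP Vc.
apply/dini_leP => e e0.
have e20 : 0 < e / 2 by rewrite divr_gt0.
have := Vc _ e20.
rewrite /= in V0 t0 *.
set v := V (lsubmx z) in V0 *.
set q := - c * v + e / 2.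
(* The sign of q - l v is not known.  As 1 - l h <= exp (- l h) <= 1, the
   factor exp (- l h) changes q - l v by at most h K, so by less than e / 2
   once h < e / 2 / K; the summand 1 avoids a division by 0. *)
set K := l * `|q - l * v| + 1.
have K0 : 0 < K by rewrite ltr_wpDl // mulr_ge0.
have eK0 : 0 < e / 2 / K by rewrite divr_gt0.
move=> Vq; near=> h => -[].
have h0 : 0 < h by near: h; exact: nbhs_right_gt.
have hK : h < e / 2 / K by near: h; exact: nbhs_right_lt.
have hV : X (lsubmx z + h *: lsubmx y) ->
    (V (lsubmx z + h *: lsubmx y) - v) / h <= q.
  by near: h; exact: Vq.
have lin : lsubmx (z + h *: y) = lsubmx z + h *: lsubmx y.
  by apply/rowP => k; rewrite !mxE.
rewrite /= lin => Xh _.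
have {hV} Vh := hV Xh.
have -> : rsubmx (z + h *: y) 0 0 = rsubmx z 0 0 + h.
  by move: y1; rewrite !mxE => ->; rewrite mulr1.
move: (rsubmx z 0 0) t0 => t t0 {Vc y1 lin Xh}.
move: Vh; set w := V _ => Vh; rewrite -/v.
rewrite ler_pdivrMr // in Vh; rewrite ler_pdivrMr //.
have -> : - (l * (t + h)) = - (l * t) + - (l * h) by ring.
rewrite expRD.
have et1 : expR (- (l * t)) <= 1 by rewrite -expR0 ler_expR oppr_le0 mulr_ge0.
have et0 := expR_ge0 (- (l * t)).
have lh0 : 0 <= l * h by rewrite mulr_ge0 // ltW.
have eh1 : expR (- (l * h)) <= 1 by rewrite -expR0 ler_expR oppr_le0.
have eh2 : 1 - l * h <= expR (- (l * h)) by exact: expR_ge1Dx.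
have eh0 := expR_ge0 (- (l * h)).
(* This is exp (l h) >= 1 + l h multiplied by exp (- l h). *)
have eh3 : 1 - expR (- (l * h)) >= l * h * expR (- (l * h)).
  have := expR_ge1Dx (l * h); have := expRxMexpNx_1 (l * h); nra.
move: (expR (- (l * t))) (expR (- (l * h))) et1 et0 eh1 eh2 eh0 eh3.
move=> a g a1 a0 g1 g2 g0 g3.
have step : g * w - v <= g * (q - l * v) * h.
  have := ler_wpM2r V0 g3; have := ler_wpM2l g0 Vh; nra.
have absorb : g * (q - l * v) <= q - l * v + e / 2.
  have hq : h * (l * `|q - l * v|) <= e / 2.
    have : h * K <= e / 2 by rewrite -ler_pdivlMr // ltW.
    rewrite /K; nra.
  have := normr_ge0 (q - l * v); have := ler_norm (- (q - l * v)).
  rewrite normrN; nra.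
have : g * w - v <= (- (c + l) * v + e) * h.
  apply: (le_trans step); apply: ler_wpM2r; first exact: ltW.
  by apply: (le_trans absorb); rewrite /q; lra.
move/(ler_wpM2l a0).
have : a * (e * h) <= e * h by rewrite ler_piMl // ltW // mulr_gt0.
lra.
Unshelve. all: by end_near.
Qed.

End AugmentedState.

(** * Comparison functions *)

Section ComparisonFunctions.
Context {R : realType}.

Lemma classK_le (alpha : R -> R) r s : classK alpha -> 0 <= r -> r <= s ->
  alpha r <= alpha s.
Proof.
move=> [_ incr _] r0; rewrite le_eqVlt => /predU1P[<- //|rs].
by rewrite ltW // incr // in_itv /= andbT // (le_trans r0) // ltW.
Qed.

Lemma classK_comp_scale (alpha : R -> R) a : 0 < a -> classK alpha ->
  classK (fun r => alpha (a * r)).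
Proof.
move=> a0 [cont incr alpha0]; split; last by rewrite mulr0.
- apply/subspace_continuousP => x /= x0.
  have ax : `[0, +oo[%classic (a * x).
    by move: x0; rewrite /= !in_itv /= !andbT => x0; rewrite mulr_ge0 // ltW.
  move/subspace_continuousP: cont => /(_ _ ax); apply: cvg_comp.
  move=> B; rewrite /within /= => nB.
  have : {for x, continuous ( *%R a)} by exact: mulrl_continuous.
  move=> /(_ _ nB); rewrite /nbhs /= => nB'; near=> t => t0.
  have : `[0, +oo[%classic (a * t) -> B (a * t) by near: t.
  apply; move: t0; rewrite /= !in_itv /= !andbT => t0.
  by rewrite mulr_ge0 // ltW.
- move=> r s; rewrite !in_itv /= !andbT => r0 s0 rs.
  by apply: incr; rewrite ?in_itv /= ?andbT ?mulr_ge0 // ?(ltW a0) // ltr_pM2l.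
Unshelve. all: by end_near.
Qed.

Lemma classKinf_scale (alpha : R -> R) a : 0 < a -> classKinf alpha ->
  classKinf (fun r => a * alpha r).
Proof.
move=> a0 [[cont incr alpha0] unbounded]; split; first split.
- apply/subspace_continuousP => x x0.
  move/subspace_continuousP: cont => /(_ _ x0); exact: cvgMl_tmp.
- by move=> r s r0 s0 rs; rewrite ltr_pM2l // incr.
- by rewrite alpha0 mulr0.
- move=> m; have [r r0 mr] := unbounded (m / a); exists r => //.
  by rewrite mulrC -ltr_pdivrMr.
Qed.

End ComparisonFunctions.

(** * Gains and jumps of the augmented subsystems *)

Section Gains.
Context {R : realType}.

(** The gain is rescaled exactly so as to undo the worst factor
    [exp (- L_j tmax_j)] by which [W_j] can undershoot [V_j]. *)
Lemma le_aug_gain n (I : pred 'I_n) (N0 : 'I_n -> nat) (delta L : 'I_n -> R)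
    (chi : 'I_n -> 'I_n -> R -> R) (i j : 'I_n) p (V : 'rV[R]_p -> R)
    (z : 'rV[R]_(aug_dim (I j) p)) :
  0 <= L j -> 0 <= V (plant z) ->
  (I j -> clock_range (N0 j) (delta j) (clock z)) ->
  (j != i -> classK (chi i j)) -> (forall r, 0 <= r -> chi i i r = 0) ->
  chi i j (V (plant z)) <=
    aug_gain I N0 delta L chi i j (aug_fun (I j) (L j) V z).
Proof.
move=> L0 V0 zT chiK chi0; rewrite /aug_gain.
have [ji|ji] := eqVneq j i.
  by move: (V _) V0 => v v0; rewrite ji chi0.
have : V (plant z) <= (if I j then expR (L j * ((N0 j)%:R * delta j)) else 1)
    * aug_fun (I j) (L j) V z.
  apply: aug_fun_ge => // /zT.
  by rewrite /clock_range /= in_itv /= => /andP[].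
have := @aug_fun_id _ _ _ (L j) V z.
move: (V _) V0 (aug_fun _ _ _ _) => v v0 w; rewrite mulrA.
case: (I j) => [_|/(_ isT) -> //]; exact: classK_le (chiK ji) v0.
Qed.

Lemma classK_aug_gain n (I : pred 'I_n) (N0 : 'I_n -> nat) (delta L : 'I_n -> R)
    (chi : 'I_n -> 'I_n -> R -> R) (i j : 'I_n) :
  j != i -> classK (chi i j) -> classK (aug_gain I N0 delta L chi i j).
Proof.
move=> /negbTE ji chiK.
have := classK_comp_scale (expR_gt0 (L j * (N0 j)%:R * delta j)) chiK.
case Ij: (I j).
- rewrite (_ : aug_gain _ _ _ _ _ _ _ =
      fun r => chi i j (expR (L j * (N0 j)%:R * delta j) * r)) //.
  by apply/funext => r; rewrite /aug_gain ji Ij.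
- rewrite (_ : aug_gain _ _ _ _ _ _ _ = chi i j) //.
  by apply/funext => r; rewrite /aug_gain ji Ij.
Qed.

(** The rate term is multiplied by [exp (- l (s - t))], where [t] and [s] are the
    clock values before and after the jump and [s >= t - delta]; the other
    terms, collected in [m], only shrink as [exp (- l s) <= 1]. *)
Lemma aug_fun_jump b p (V : 'rV[R]_p -> R) (G : set 'rV[R]_p)
    (l d delta m : R) (z y : 'rV[R]_(aug_dim b p)) :
  0 <= l -> 0 <= V (plant z) -> 0 <= m ->
  aug_set b G [set Num.max 0 (clock z - delta)] y ->
  V (plant y) <= Num.max (expR (- d) * V (plant z)) m ->
  aug_fun b l V y <=
    Num.max (expR (- (if b then d - l * delta else d)) * aug_fun b l V z) m.
Proof.
case: b z y => //= z y l0 V0 m0 [_ /= ->] Vy.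
set t := rsubmx z 0 0; set s := Num.max _ _.
have s0 : 0 <= s by rewrite le_max lexx.
have ts : t - delta <= s by rewrite le_max lexx orbT.
rewrite (le_trans (ler_wpM2l (expR_ge0 _) Vy)) // maxr_pMr ?expR_ge0 //.
rewrite ge_max !le_max; apply/andP; split; apply/orP.
- left; rewrite !mulrA -!expRD ler_wpM2r // ler_expR; nra.
- by right; rewrite ler_piMl // -expR0 ler_expR oppr_le0 mulr_ge0.
Qed.

End Gains.

(** * Lyapunov functions of the augmented interconnection *)

Theorem proposition6 (R : realType) (n M : nat) (N : 'I_n -> nat)
    (S : @interconnection R n N M)
    (V : forall j : 'I_n, 'rV[R]_(N j) -> R)
    (A : forall j : 'I_n, set 'rV[R]_(N j))
    (c d : 'I_n -> R) (chi : 'I_n -> 'I_n -> R -> R) (chiu : 'I_n -> R -> R)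
    (N0 : 'I_n -> nat) (delta L : 'I_n -> R) :
  (2 <= n)%N ->
  well_formed S ->
  (forall j, [/\ A j !=set0, compact (A j) & A j `<=` sys_X S j]) ->
  (forall j, candidate_exp_ISS_Lyapunov S V (A j) (c j) (d j) (chi j) (chiu j)) ->
  (forall j, unstable_flow c j -> (1 <= N0 j)%N /\ 0 < delta j) ->
  (forall j, 0 <= L j) ->
  forall i : 'I_n, exists tchiu : R -> R,
    candidate_exp_ISS_Lyapunov
      (augment S (unstable_flow c) N0 delta)
      (fun j => aug_fun (unstable_flow c j) (L j) (V j))
      (aug_set (unstable_flow c i) (A i) (clock_range (N0 i) (delta i)))
      (if unstable_flow c i then c i + L i else c i)
      (if unstable_flow c i then d i - L i * delta i else d i)
      (aug_gain (unstable_flow c) N0 delta L chi i)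
      tchiu.
Proof.
move=> _ [CX DX _ _ _] compactA candV _ L0 i; exists (chiu i).
have V_ge0 j x : sys_X S j x -> 0 <= V j x by case: (candV j) => + _; exact.
have [_ [lipV [[psi1 [psi2 [psi1K psi2K psiV]]]]]] := candV i.
move=> [chiK [chi0 [chiuK [flowV jumpV]]]].
have [A0 _ _] := compactA i.
pose T j := clock_range (N0 j) (delta j).
have T_ge0 j t : T j t -> 0 <= t.
  by rewrite /T /clock_range /= in_itv /= => /andP[].
have max_le (z : state (fun j => aug_dim (unstable_flow c j) (N j)))
      (u : 'rV[R]_M) : (forall j, sys_X S j (plant (z j))) ->
    (forall j, unstable_flow c j -> T j (clock (z j))) ->
    Num.max (\big[Num.max/0]_(j < n) chi i j (V j (plant (z j))))
            (chiu i (enorm u)) <=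
    Num.max (\big[Num.max/0]_(j < n)
               aug_gain (unstable_flow c) N0 delta L chi i j
                 (aug_fun (unstable_flow c j) (L j) (V j) (z j)))
            (chiu i (enorm u)).
  move=> Xz Tz; rewrite ge_max !le_max lexx orbT andbT; apply/orP; left.
  apply: le_bigmax2 => j _; apply: le_aug_gain => //; first exact: V_ge0.
  - exact: Tz.
  - exact: chiK.
split; [|split; [|split; [|split; [|split; [|split; [|split]]]]]].
- by move=> z /aug_setP[Xz _]; exact/aug_fun_ge0/V_ge0.
- by rewrite /= aug_setD; apply: locally_lipschitz_aug => //; exact: T_ge0.
- pose a := if unstable_flow c i then expR (L i * ((N0 i)%:R * delta i)) else 1.
  have a0 : 0 < a by rewrite /a; case: ifP => // _; exact: expR_gt0.
  exists (fun r => a^-1 * psi1 r), psi2; split => //.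
    by apply: classKinf_scale; rewrite ?invr_gt0.
  move=> z /aug_setP[Xz Tz].
  rewrite dist_to_aug //; have /andP[psi1V Vpsi2] := psiV _ Xz.
  rewrite (le_trans (aug_fun_le _ _ _) Vpsi2) ?andbT ?V_ge0 //; last first.
    by move/Tz; exact: T_ge0.
  rewrite ler_pdivrMl // (le_trans psi1V) // aug_fun_ge ?V_ge0 // => /Tz.
  by rewrite /clock_range /= in_itv /= => /andP[].
- by move=> j ji; apply: classK_aug_gain => //; exact: chiK.
- by move=> r _; rewrite /aug_gain eqxx.
- exact: chiuK.
- move=> z u [Cz Cu] nAz W_ge y Fy.
  have Cx j : sys_C S j (plant (z j)) by have /aug_setP[] := Cz j.
  have Tz j : unstable_flow c j -> T j (clock (z j)) by have /aug_setP[] := Cz j.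
  have Xz j : sys_X S j (plant (z j)) by exact/CX/Cx.
  have tz : unstable_flow c i -> 0 <= clock (z i) by move=> /Tz/T_ge0.
  apply: (dini_aug _ _ _ tz Fy) => //; first exact: V_ge0.
  apply: (flowV (fun j => plant (z j)) u); first by split.
  + by move=> Az; apply: nAz; apply/aug_setP; split=> //; exact: Tz.
  + rewrite (le_trans (max_le z u Xz Tz)) // (le_trans W_ge) //.
    by apply: aug_fun_le => //; exact: V_ge0.
  + by have /aug_setP[] := Fy.
- move=> z u [Dz Du] y Gy.
  have Dx j : sys_D S j (plant (z j)) by have /aug_setP[] := Dz j.
  have Tz j : unstable_flow c j -> T j (clock (z j)) by have /aug_setP[] := Dz j.
  have Xz j : sys_X S j (plant (z j)) by exact/DX/Dx.
  apply: (aug_fun_jump _ _ _ Gy) => //.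
  + exact: V_ge0.
  + by rewrite le_max bigmax_ge_id.
  + have /aug_setP[Gx _] := Gy.
    apply: (le_trans (jumpV (fun j => plant (z j)) u _ _ Gx)); first by split.
    rewrite ge_max !le_max lexx /=.
    by have := max_le z u Xz Tz; rewrite le_max => ->; rewrite orbT.
Qed.
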